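(* Let $A$ be a simple algebra over a field $F$ with $\mathrm{char}(F)\neq 2$. If every derivation from $A$ to its dual $A$-bimodule $A^*$ is inner, then $A$ is zero Lie product determined.
   Context: Algebras are associative and not necessarily unital. For $x,y\in A$, $[x,y]=xy-yx$. The dual space $A^*$ of $A$ (all $F$-linear functionals on $A$) is an $A$-bimodule via $(x\cdot f)(y)=f(yx)$ and $(f\cdot x)(y)=f(xy)$ for $x,y\in A$, $f\in A^*$. A derivation from $A$ to an $A$-bimodule $M$ is a linear map $\delta:A\to M$ with $\delta(yz)=\delta(y)\cdot z+y\cdot\delta(z)$ for all $y,z\in A$; it is inner if there exists $\tau\in M$ such that $\delta(x)=\tau\cdot x-x\cdot\tau$ for all $x\in A$. An $F$-algebra $A$ is zero Lie product determined (zLpd) if, for every vector space $X$ over $F$ and every bilinear map $\Phi:A\times A\to X$ such that $\Phi(x,y)=0$ whenever $[x,y]=0$, there exists a linear map $\tau:A\to X$ such that $\Phi(x,y)=\tau([x,y])$ for all $x,y\in A$. *)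

(* Defs.v *)
From HB Require Import structures.
From mathcomp Require Import all_boot all_order all_algebra.
From mathcomp Require Import boolp classical_sets.

Set Implicit Arguments.
Unset Strict Implicit.
Unset Printing Implicit Defensive.

Import GRing.Theory.

Local Open Scope ring_scope.
Local Open Scope classical_set_scope.

(* The [algType] of ssralg is unital; here no identity element is required,
   and no condition is put on the dimension. *)
HB.mixin Record Lmodule_isAssocAlgebra (F : fieldType) A
    of GRing.Lmodule F A := {
  amul : A -> A -> A;
  amulA : associative amul;
  amul_bilinear : bilinear_for *:%R *:%R amul;
}.

#[short(type="assocAlgType")]
HB.structure Definition AssocAlgebra (F : fieldType) :=
  {A of GRing.Lmodule F A & Lmodule_isAssocAlgebra F A}.

Notation "x ** y" := (amul x y) (at level 40, left associativity) : ring_scope.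

HB.instance Definition _ (F : fieldType) (A : assocAlgType F) :=
  bilinear_isBilinear.Build F A A A *:%R *:%R (@amul F A) amul_bilinear.

Definition lie (F : fieldType) (A : assocAlgType F) (x y : A) : A :=
  x ** y - y ** x.

Definition ideal (F : fieldType) (A : assocAlgType F) (I : set A) : Prop :=
  [/\ I 0,
      forall x y, I x -> I y -> I (x + y),
      forall (a : F) x, I x -> I (a *: x)
    & forall x y, I y -> I (x ** y) /\ I (y ** x)].

(* Without identity, the usual nondegeneracy condition is A^2 <> 0. *)
Definition simple_algebra (F : fieldType) (A : assocAlgType F) : Prop :=
  (exists x y : A, x ** y <> 0) /\
  (forall I : set A, ideal I -> I = [set 0] \/ I = [set: A]).

HB.mixin Record Lmodule_isBimodule (F : fieldType) (A : assocAlgType F) M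
    of GRing.Lmodule F M := {
  lact : A -> M -> M;
  ract : M -> A -> M;
  lact_bilinear : bilinear_for *:%R *:%R lact;
  ract_bilinear : bilinear_for *:%R *:%R ract;
  lactM : forall x y m, lact (x ** y) m = lact x (lact y m);
  ractM : forall x y m, ract m (x ** y) = ract (ract m x) y;
  lractA : forall x y m, lact x (ract m y) = ract (lact x m) y;
}.

#[short(type="bimodType")]
HB.structure Definition Bimodule (F : fieldType) (A : assocAlgType F) :=
  {M of GRing.Lmodule F M & Lmodule_isBimodule F A M}.

Definition derivation (F : fieldType) (A : assocAlgType F) (M : bimodType A)
    (d : {linear A -> M}) : Prop :=
  forall y z : A, d (y ** z) = ract (d y) z + lact y (d z).

Definition inner (F : fieldType) (A : assocAlgType F) (M : bimodType A)
    (d : {linear A -> M}) : Prop :=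
  exists t : M, forall x : A, d x = ract t x - lact x t.

(* All linear functionals, as no topology is involved: [{scalar A}] is the type
   of linear maps from [A] to the base field. *)
Definition dual (F : fieldType) (A : assocAlgType F) := {scalar A}.

Section Dual.
Variables (F : fieldType) (A : assocAlgType F).
Local Notation D := (dual A).
Implicit Types (f g h : D) (a b : F) (x y : A).

Lemma dualP f g : (forall x, f x = g x) -> f = g.
Proof.
case: f g => [f cf] [g cg] /= /funext fg.
case: _ / fg in cg *.
congr GRing.Linear.Pack.
case: cf cg => [[cf] [lf]] [[cg] [lg]].
by congr (GRing.Linear.Class _ _); congr (_ _); apply: Prop_irrelevance.
Qed.

HB.instance Definition _ := gen_eqMixin D.
HB.instance Definition _ := gen_choiceMixin D.

Definition dual_zero : D := \0.
Definition dual_opp f : D := \- f.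
Definition dual_add f g : D := f \+ g.
Definition dual_scale_fun a f : A -> F := fun x => a * f x.
Lemma dual_scale_linear a f : scalar (dual_scale_fun a f).
Proof.
by move=> b x y; rewrite /dual_scale_fun linearP mulrDr mulrCA.
Qed.
HB.instance Definition _ a f := GRing.isLinear.Build F A F *%R
  (dual_scale_fun a f) (dual_scale_linear a f).
Definition dual_scale a f : D := dual_scale_fun a f.

Lemma dual_addA : associative dual_add.
Proof. by move=> f g h; apply: dualP => x /=; rewrite addrA. Qed.
Lemma dual_addC : commutative dual_add.
Proof. by move=> f g; apply: dualP => x /=; rewrite addrC. Qed.
Lemma dual_add0 : left_id dual_zero dual_add.
Proof. by move=> f; apply: dualP => x /=; rewrite add0r. Qed.
Lemma dual_addN : left_inverse dual_zero dual_opp dual_add.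
Proof. by move=> f; apply: dualP => x /=; rewrite addNr. Qed.

HB.instance Definition _ :=
  GRing.isZmodule.Build D dual_addA dual_addC dual_add0 dual_addN.

Lemma dual_scaleA a b f : dual_scale a (dual_scale b f) = dual_scale (a * b) f.
Proof. by apply: dualP => x; rewrite /= /dual_scale_fun /= ?/dual_scale_fun mulrA. Qed.
Lemma dual_scale1 : left_id 1 dual_scale.
Proof. by move=> f; apply: dualP => x; rewrite /= /dual_scale_fun /= ?/dual_scale_fun mul1r. Qed.
Lemma dual_scaleDr : right_distributive dual_scale +%R.
Proof. by move=> a f g; apply: dualP => x; rewrite /= /dual_scale_fun /= ?/dual_scale_fun mulrDr. Qed.
Lemma dual_scaleDl f : {morph dual_scale^~ f : a b / a + b}.
Proof. by move=> a b; apply: dualP => x; rewrite /= /dual_scale_fun /= ?/dual_scale_fun mulrDl. Qed.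

HB.instance Definition _ := GRing.Zmodule_isLmodule.Build F D
  dual_scaleA dual_scale1 dual_scaleDr dual_scaleDl.

Lemma dual_addE f g x : (f + g) x = f x + g x. Proof. by []. Qed.
Lemma dual_scaleE a f x : (a *: f) x = a * f x. Proof. by []. Qed.

Definition dual_lact_fun x f : A -> F := fun y => f (y ** x).
Definition dual_ract_fun f x : A -> F := fun y => f (x ** y).

Lemma dual_lact_linear x f : scalar (dual_lact_fun x f).
Proof.
by move=> a y z; rewrite /dual_lact_fun (amul_bilinear.1 x a) linearP.
Qed.
Lemma dual_ract_linear f x : scalar (dual_ract_fun f x).
Proof.
by move=> a y z; rewrite /dual_ract_fun (amul_bilinear.2 x a) linearP.
Qed.

HB.instance Definition _ x f := GRing.isLinear.Build F A F *%R
  (dual_lact_fun x f) (dual_lact_linear x f).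
HB.instance Definition _ f x := GRing.isLinear.Build F A F *%R
  (dual_ract_fun f x) (dual_ract_linear f x).

Definition dual_lact x f : D := dual_lact_fun x f.
Definition dual_ract f x : D := dual_ract_fun f x.

Lemma dual_lact_bilinear : bilinear_for *:%R *:%R dual_lact.
Proof.
split=> [f|x] a u v; apply: dualP => y.
  by rewrite /= /dual_lact_fun (amul_bilinear.2 y a) linearP.
by [].
Qed.
Lemma dual_ract_bilinear : bilinear_for *:%R *:%R dual_ract.
Proof.
split=> [x|f] a u v; apply: dualP => y; first by [].
by rewrite /= /dual_ract_fun (amul_bilinear.1 y a) linearP.
Qed.
Lemma dual_lactM x y f : dual_lact (x ** y) f = dual_lact x (dual_lact y f).
Proof. by apply: dualP => z; rewrite /= /dual_lact_fun /= /dual_lact_fun amulA. Qed.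
Lemma dual_ractM x y f : dual_ract f (x ** y) = dual_ract (dual_ract f x) y.
Proof. by apply: dualP => z; rewrite /= /dual_ract_fun /= /dual_ract_fun amulA. Qed.
Lemma dual_lractA x y f : dual_lact x (dual_ract f y) = dual_ract (dual_lact x f) y.
Proof.
by apply: dualP => z;
  rewrite /= /dual_lact_fun /dual_ract_fun /= /dual_lact_fun /dual_ract_fun amulA.
Qed.

HB.instance Definition _ := Lmodule_isBimodule.Build F A D
  dual_lact_bilinear dual_ract_bilinear dual_lactM dual_ractM dual_lractA.

Lemma dual_lactE x f y : (lact x f : D) y = f (y ** x). Proof. by []. Qed.
Lemma dual_ractE f x y : (ract f x : D) y = f (x ** y). Proof. by []. Qed.

End Dual.

Definition zLpd (F : fieldType) (A : assocAlgType F) : Prop :=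
  forall (X : lmodType F) (Phi : {bilinear A -> A -> X}),
    (forall x y : A, lie x y = 0 -> Phi x y = 0) ->
    exists tau : {linear A -> X}, forall x y : A, Phi x y = tau (lie x y).

(* Main.v *)
(** Let [Phi] vanish on commuting pairs and compose it with a linear form.  From
    [Phi u u = 0] and [Phi (u u) u = 0] the map [x |-> Phi x _] is a Jordan
    derivation [A -> A^*].  If [f] is its Leibniz defect at [x, y] and
    [c = [x, y]], Herstein's computation gives [f (z c t + t c z) = 0], hence
    [2 f] vanishes on [A c A c A], which is [A] by simplicity when [c <> 0].
    So it is a derivation, thus inner by hypothesis, and its composite with
    [Phi] factors through the bracket.  As linear forms separate points, a
    relation [\sum [x_i, y_i] = 0] forces [\sum Phi x_i y_i = 0], and the
    induced map on [[A, A]] extends linearly to [A]. *)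

Require Import Defs.
From HB Require Import structures.
From mathcomp Require Import all_boot all_algebra.
From mathcomp Require Import boolp classical_sets ring.

Set Implicit Arguments.
Unset Strict Implicit.
Unset Printing Implicit Defensive.

Import GRing.Theory.
Local Open Scope ring_scope.
Local Open Scope classical_set_scope.

(** Reduces an equation to a known one, so that [ring] has only the difference to check. *)
Lemma eq_of_subr_eq (V : zmodType) (a b c e : V) :
  c = e -> a - b = c - e -> a = b.
Proof. by move=> ->; rewrite subrr => /subr0_eq. Qed.

(** * Jordan derivations into the dual bimodule *)

Section JordanDerivation.
Variables (F : fieldType) (A : assocAlgType F) (d : {linear A -> dual A}).
Hypothesis two_neq0 : (2 : F) != 0.
Hypothesis jordan : forall x, d (x ** x) = ract (d x) x + lact x (d x).

Lemma jordan_square x w : d (x ** x) w = d x (x ** w) + d x (w ** x).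
Proof. by rewrite jordan dual_addE dual_lactE dual_ractE. Qed.

Lemma jordan_polar x y w :
  d (x ** y) w + d (y ** x) w =
  d x (y ** w) + d y (w ** x) + d y (x ** w) + d x (w ** y).
Proof.
have := jordan_square (x + y) w.
rewrite !(linearDl, linearDr, linearD) /= !jordan_square => H.
by apply: (eq_of_subr_eq H); ring.
Qed.

(** With u o v = uv + vu one has 2 xyx = x o (x o y) - (x x) o y, so the polarized identity
    determines [d] on xyx after division by 2. *)
Lemma jordan_sandwich x y w :
  d (x ** y ** x) w = d x (y ** x ** w) + d y (x ** w ** x) + d x (w ** x ** y).
Proof.
apply: (mulfI two_neq0).
have H1 := jordan_polar x (x ** y) w.
have H2 := jordan_polar x (y ** x) w.
have H3 := jordan_polar (x ** x) y w.
have H4 := jordan_polar x y (x ** w).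
have H5 := jordan_polar x y (w ** x).
rewrite !jordan_square in H3.
rewrite !amulA in H1 H2 H3 H4 H5 *.
have -> : 2 * d (x ** y ** x) w =
  (d (x ** x ** y) w + d (x ** y ** x) w) +
  (d (x ** y ** x) w + d (y ** x ** x) w) -
  (d (x ** x ** y) w + d (y ** x ** x) w) by ring.
rewrite H1 H2 H3.
apply: (eq_of_subr_eq (congr2 +%R H4 H5)); ring.
Qed.

Lemma jordan_sandwich_polar u v z w :
  d (u ** z ** v) w + d (v ** z ** u) w =
  d u (z ** v ** w) + d z (v ** w ** u) + d v (w ** u ** z) +
  (d v (z ** u ** w) + d z (u ** w ** v) + d u (w ** v ** z)).
Proof.
have := jordan_sandwich (u + v) z w.
rewrite !(linearDl, linearDr, linearD) /= !jordan_sandwich => H.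
by apply: (eq_of_subr_eq H); ring.
Qed.

Definition leibniz_defect x y : dual A :=
  d (x ** y) - (ract (d x) y + lact x (d y)).

Lemma leibniz_defectE x y w :
  leibniz_defect x y w = d (x ** y) w - (d x (y ** w) + d y (w ** x)).
Proof. by []. Qed.

(* Expand [d (x y z y x + y x z x y)] both as [x (y z y) x + y (x z x) y] and as
   [(x y) z (y x) + (y x) z (x y)]. *)
Lemma leibniz_defect_lie x y z w :
  leibniz_defect x y (z ** lie x y ** w) =
  - leibniz_defect x y (w ** lie x y ** z).
Proof.
have H1 := jordan_sandwich x (y ** z ** y) w.
have H2 := jordan_sandwich y (x ** z ** x) w.
have H3 := jordan_sandwich_polar (x ** y) (y ** x) z w.
(* These two trade the terms in [d (y ** x)] left by [H3] for terms in [d (x ** y)]. *)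
have H4 := jordan_polar x y (z ** x ** y ** w).
have H5 := jordan_polar x y (w ** x ** y ** z).
rewrite !amulA !jordan_sandwich !amulA in H1 H2 H3 H4 H5.
rewrite H1 H2 in H3.
rewrite !leibniz_defectE /lie.
rewrite !(linearBl, linearBr, linearB) /= !amulA.
apply: (eq_of_subr_eq (congr2 +%R H3 (congr2 +%R H4 H5))).
ring.
Qed.

Lemma leibniz_defectC x y : leibniz_defect y x = - leibniz_defect x y.
Proof.
apply: dualP => w; transitivity (- leibniz_defect x y w); last by [].
rewrite !leibniz_defectE.
by apply: (eq_of_subr_eq (jordan_polar x y w)); ring.
Qed.

Lemma leibniz_defectDl x x' y :
  leibniz_defect (x + x') y = leibniz_defect x y + leibniz_defect x' y.
Proof.
apply: dualP => w; rewrite dual_addE !leibniz_defectE.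
rewrite !(linearDl, linearDr, linearD) /=; ring.
Qed.

Lemma leibniz_defectDr x y y' :
  leibniz_defect x (y + y') = leibniz_defect x y + leibniz_defect x y'.
Proof.
by rewrite leibniz_defectC leibniz_defectDl opprD -!leibniz_defectC.
Qed.

(* Moving the two factors [lie x y] past the end of the word in turn gives
   [f (t c z c y) = - f (t c z c y)] for the defect [f] and [c = lie x y]. *)
Lemma leibniz_defect_lie2 x y t z w :
  leibniz_defect x y (t ** lie x y ** z ** lie x y ** w) = 0.
Proof.
set f := leibniz_defect x y; set c := lie x y.
have cyc u v : f (u ** c ** v) = - f (v ** c ** u) := leibniz_defect_lie x y u v.
have e1 := cyc t (z ** c ** w); have e2 := cyc z (w ** c ** t).
have e3 := cyc w (t ** c ** z); rewrite !amulA in e1 e2 e3.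
apply: (mulfI two_neq0); rewrite mulr0 mulr_natl mulr2n.
by rewrite {1}e1 e2 e3 !opprK addNr.
Qed.

End JordanDerivation.

(** * Functionals and Jordan derivations on a simple algebra *)

Section Simple.
Variables (F : fieldType) (A : assocAlgType F).
Hypothesis simpleA : simple_algebra A.

Lemma simple_ideal_full (I : set A) (c : A) :
  ideal I -> I c -> c <> 0 -> forall x, I x.
Proof.
move=> idI Ic c0 x; case: (simpleA.2 I idI) => [I0|->//].
by rewrite I0 in Ic.
Qed.

Lemma simple_dual_eq0_lact (f : dual A) : (forall y, lact y f = 0) -> f = 0.
Proof.
move=> f0.
have fM x y : f (x ** y) = 0 by rewrite -dual_lactE f0.
have [[x [y xy0]] _] := simpleA.
(* The span of all products, described by duality as a common kernel. It is a nonzero ideal, hence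
   all of A. *)
pose I : set A := fun w => forall g : dual A, (forall x y, g (x ** y) = 0) -> g w = 0.
have idI : ideal I.
  split=> [g _|u v Iu Iv g g0|a u Iu g g0|u v _]; first exact: linear0.
  - by rewrite linearD /= Iu // Iv // addr0.
  - by rewrite linearZ /= Iu // mulr0.
  - by split=> g g0; apply: g0.
have Ixy : I (x ** y) by move=> g; apply.
by apply: dualP => w; apply: (simple_ideal_full idI Ixy xy0).
Qed.

Lemma simple_dual_eq0 (f : dual A) (c : A) : c <> 0 ->
  (forall t z y, f (t ** c ** z ** c ** y) = 0) -> f = 0.
Proof.
move=> c0 fc.
(* [I] frees the first [c]; [J] then frees the second, with the first already arbitrary. *)
pose I : set A := fun u => forall t z y, f (t ** u ** z ** c ** y) = 0.
have idI : ideal I.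
  split=> [t z y|u v Iu Iv t z y|a u Iu t z y|u v Iv].
  - by rewrite linear0r !linear0l linear0.
  - by rewrite linearDr !linearDl linearD /= Iu Iv addr0.
  - by rewrite linearZr !linearZl linearZ /= Iu mulr0.
  - by split=> t z y; rewrite amulA ?Iv // -[t ** v ** u ** z]amulA Iv.
pose J : set A := fun v => forall t u z y, f (t ** u ** z ** v ** y) = 0.
have idJ : ideal J.
  split=> [t u z y|v v' Jv Jv' t u z y|a v Jv t u z y|v v' Jv'].
  - by rewrite linear0r !linear0l linear0.
  - by rewrite linearDr !linearDl linearD /= Jv Jv' addr0.
  - by rewrite linearZr !linearZl linearZ /= Jv mulr0.
  - split=> t u z y; rewrite amulA; last by rewrite -amulA Jv'.
    by rewrite -[t ** u ** z ** v]amulA Jv'.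
have fI : forall u, I u by apply: (@simple_ideal_full _ c).
have fJ : forall v, J v.
  by apply: (@simple_ideal_full _ c) => // t u z y; apply: fI.
(* Now [f] kills all products of five factors; four are peeled off from the right. *)
do 4!apply: simple_dual_eq0_lact => ?.
by apply: dualP => t; apply: fJ.
Qed.

(** The defect vanishes on noncommuting pairs. By additivity a commuting pair is shifted to a
    noncommuting one: in [x] if [y] is not central, otherwise first in [y] by the noncentral [v]. *)
Lemma simple_jordan_derivation (d : {linear A -> dual A}) :
  (2 : F) != 0 -> (exists x y : A, lie x y <> 0) ->
  (forall x, d (x ** x) = ract (d x) x + lact x (d x)) -> derivation d.
Proof.
move=> two_neq0 [u [v uv0]] jordan.
have h0 x y : lie x y <> 0 -> leibniz_defect d x y = 0.
  move=> c0; apply: (simple_dual_eq0 c0) => t z w.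
  exact: leibniz_defect_lie2.
have hx x y : (exists z, lie z y <> 0) -> leibniz_defect d x y = 0.
  move=> [z zy]; have [xy|/h0//] := pselect (lie x y = 0).
  have /h0 : lie (x + z) y <> 0.
    move: xy zy; rewrite /lie linearDl linearDr /= => xy.
    by rewrite opprD addrACA xy add0r.
  by rewrite leibniz_defectDl // (h0 _ _ zy) addr0.
suff defect0 x y : leibniz_defect d x y = 0.
  by move=> x y; apply/subr0_eq; apply: defect0.
have [/hx//|ncy] := pselect (exists z, lie z y <> 0).
have /(hx x) : exists z, lie z (y + v) <> 0.
  exists u; move: uv0; rewrite /lie linearDl linearDr /= opprD addrACA.
  have -> : u ** y - y ** u = 0 by apply: contrapT => ?; apply: ncy; exists u.
  by rewrite add0r.
by rewrite leibniz_defectDr // (hx _ v) ?addr0 //; exists u.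
Qed.

End Simple.

(** * Extension of linear maps *)

(** Partial linear maps are encoded by their graphs, so that Zorn's lemma applies to plain
    inclusion. *)
Lemma linear_extension (F : fieldType) (V X : lmodType F) (G : set (V * X)) :
  G 0 -> (forall a p q, G p -> G q -> G (a *: p + q)) ->
  (forall x, G (0, x) -> x = 0) ->
  exists f : {linear V -> X}, forall p, G p -> f p.1 = p.2.
Proof.
move=> G0 Glin Gfun.
(* The guard [H !=set0] is there because the union of the empty chain is empty. *)
pose P (H : set (V * X)) :=
  [/\ H !=set0 -> G `<=` H,
      forall a p q, H p -> H q -> H (a *: p + q)
    & forall x, H (0, x) -> x = 0].
have [C CP Ctot|H [[GH Hlin Hfun] Hmax]] := @Zorn_bigcup _ P.
  split=> [[p [Y CY Yp]] q Gq|a p q [Y CY Yp] [Z CZ Zq]|x [Y CY Yx]].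
  - by exists Y => //; have [YG _ _] := CP _ CY; apply: YG => //; exists p.
  - have [YZ|ZY] := Ctot _ _ CY CZ.
      by exists Z => //; have [_ Zl _] := CP _ CZ; apply: Zl => //; apply: YZ.
    by exists Y => //; have [_ Yl _] := CP _ CY; apply: Yl => //; apply: ZY.
  - by have [_ _ Yf] := CP _ CY; apply: Yf.
have {}GH : G `<=` H.
  have [/GH//|H0] := pselect (H !=set0).
  have PG : P G by split=> // _ p.
  case: (Hmax G) => //; split=> [p Hp|GsubH]; first by case: H0; exists p.
  by apply: H0; exists 0; apply: GsubH.
have dom v : exists x, H (v, x).
  (* If [v] is outside the domain, the graph grows by sending [v] to 0. *)
  apply: contrapT => nv; pose K : set (V * X) :=
    fun q => exists p a, H p /\ q = p + a *: (v, 0).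
  have HK : H `<=` K by move=> p Hp; exists p, 0; rewrite scale0r addr0.
  case: (Hmax K); last first.
    split; first by move=> _; apply: subset_trans HK.
      move=> a _ _ [p [b [Hp ->]]] [q [c [Hq ->]]].
      exists (a *: p + q), (a * b + c); split; first exact: Hlin.
      by rewrite scalerDr scalerDl -!scalerA addrACA.
    move=> x [[u y] [a [Hu /= [/esym/eqP uv ->]]]].
    (* A nonzero [a] would put [v] in the domain of [H]. *)
    have [a0|a0] := eqVneq a 0; last first.
      case: nv; exists (- a^-1 *: y); move: uv; rewrite addrC addr_eq0 => /eqP av.
      have := Hlin (- a^-1) _ 0 Hu (GH _ G0); rewrite addr0 /=.
      suff -> : v = - a^-1 *: u by [].
      by rewrite scaleNr -scalerN -av scalerA mulVf // scale1r.
    move: uv; rewrite a0 !scale0r !addr0 => /eqP u0.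
    by apply: Hfun; rewrite -u0.
  split=> // KH; apply: nv; exists 0; apply: KH; exists 0, 1.
  by rewrite add0r scale1r; split=> //; apply: GH.
have [f Hf] := choice dom.
have Huniq v x y : H (v, x) -> H (v, y) -> x = y.
  move=> Hx Hy; apply/subr0_eq/Hfun.
  have := Hlin (-1) _ _ Hy Hx; rewrite /= scaleN1r addrC.
  by rewrite (_ : (v, x) - (v, y) = (0, x - y)) //; congr (_, _); apply: subrr.
have flin : linear f.
  move=> a u v; apply: (Huniq (a *: u + v)); first exact: Hf.
  exact: (Hlin a _ _ (Hf u) (Hf v)).
pose m := GRing.isLinear.Build F V X *:%R f flin.
pose g : {linear V -> X} := HB.pack f m.
by exists g => -[v x] /GH Hvx; apply: Huniq (Hf v) Hvx.
Qed.

(** Extends the coordinate map of the line spanned by [x], which takes the value 1 at [x]. *)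
Lemma linear_form_neq0 (F : fieldType) (X : lmodType F) (x : X) :
  x != 0 -> exists f : {linear X -> F^o}, f x != 0.
Proof.
move=> x0; pose G : set (X * F^o) := fun p => p.1 = p.2 *: x.
have [||y /= /esym/eqP|f Gf] := @linear_extension F X F^o G.
- by rewrite /G /= scale0r.
- by move=> a p q; rewrite /G /= => -> ->; rewrite scalerA scalerDl.
- by rewrite scaler_eq0 (negbTE x0) orbF => /eqP.
by exists f; rewrite (Gf (x, 1)) ?oner_neq0 // /G /= scale1r.
Qed.

(** * The Jordan derivation attached to a bilinear map *)

Section BilinearForm.
Variables (F : fieldType) (A : assocAlgType F) (X : lmodType F).
Variables (Phi : {bilinear A -> A -> X}) (f : {linear X -> F^o}).

Definition form_at x : A -> F := fun y => f (Phi x y).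

Lemma form_at_linear x : scalar (form_at x).
Proof. by move=> a y z; rewrite /form_at linearPr linearP. Qed.
HB.instance Definition _ x := GRing.isLinear.Build F A F *%R
  (form_at x) (form_at_linear x).

Definition form_dual x : dual A := form_at x.

Lemma form_dual_linear : linear form_dual.
Proof.
move=> a x y; apply: dualP => z.
by rewrite dual_addE dual_scaleE /= /form_at linearPl linearP.
Qed.
HB.instance Definition _ := GRing.isLinear.Build F A (dual A) *:%R
  form_dual form_dual_linear.

(* Linearize [Phi u u = 0] and [Phi (u ** u) u = 0]. *)
Lemma form_dual_jordan x :
  (2 : F) != 0 -> (forall x y : A, lie x y = 0 -> Phi x y = 0) ->
  form_dual (x ** x) = ract (form_dual x) x + lact x (form_dual x).
Proof.
move=> two_neq0 Phi0; apply: dualP => w.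
rewrite dual_addE dual_lactE dual_ractE /= /form_at.
have alt u : f (Phi u u) = 0 by rewrite Phi0 ?linear0 // /lie subrr.
have sq u : f (Phi (u ** u) u) = 0.
  by rewrite Phi0 ?linear0 // /lie amulA subrr.
have anti u v : f (Phi u v) = - f (Phi v u).
  apply/eqP; rewrite -addr_eq0; apply/eqP; have := alt (u + v).
  by rewrite linearDl !linearDr !linearD /= !alt add0r addr0.
rewrite [f (Phi x _)]anti [f (Phi x (w ** x))]anti.
apply: (mulfI two_neq0).
(* [SD - SB] is twice the part of odd degree in [w]; subtracting [Sw] twice leaves the part linear
   in [w]. *)
have Sw := sq w; have SD := sq (x + w); have SB := sq (x - w).
rewrite !(linearDl, linearDr, linearD) /= in SD SB.
rewrite !(linearNl, linearNr) ![f (- _)]linearN !opprK /= in SB.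
apply: (eq_of_subr_eq (congr2 (fun a b => a - b)
  (congr2 (fun a b => a - b) SD SB) (congr2 +%R Sw Sw))).
by ring.
Qed.
End BilinearForm.

(** * Factorization through the Lie bracket *)

Theorem corollary2p5 (F : fieldType) (A : assocAlgType F)
    (charF : 2%N \notin [pchar F])
    (simpleA : simple_algebra A)
    (innerA : forall d : {linear A -> dual A}, derivation d -> inner d) :
  zLpd A.
Proof.
move=> X Phi Phi0.
have two_neq0 : (2 : F) != 0 by move: charF; rewrite inE.
have [nc|comm] := pselect (exists x y : A, lie x y <> 0); last first.
  exists \0 => x y /=; apply: Phi0; apply: contrapT => xy.
  by apply: comm; exists x, y.
have tauP (f : {linear X -> F^o}) :
    exists t : dual A, forall x y, f (Phi x y) = t (lie x y).
  pose d : {linear A -> dual A} := form_dual Phi f.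
  have [t dt] : inner d.
    apply: innerA; apply: simple_jordan_derivation => // x.
    by apply: form_dual_jordan.
  exists t => x y; have -> : f (Phi x y) = d x y by [].
  by rewrite dt /lie linearB.
(* The graph of the induced map on the span of the brackets; [tauP] serves to show that it is
   single-valued. *)
pose G : set (A * X) := fun p => exists s : seq (A * A),
  p = \sum_(q <- s) (lie q.1 q.2, Phi q.1 q.2).
have lieZ a (x y : A) : lie (a *: x) y = a *: lie x y.
  by rewrite /lie linearZl linearZr /= scalerBr.
have [|a _ _ [s ->] [r ->]|x [s]|tau tauG] := @linear_extension F A X G.
- by exists [::]; rewrite big_nil.
- exists ([seq (a *: q.1, q.2) | q <- s] ++ r).
  rewrite big_cat big_map scaler_sumr; congr (_ + _); apply: eq_bigr => q _ /=.
  by rewrite lieZ linearZl.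
- move=> sE; apply/eqP; apply: contrapT => /negP /linear_form_neq0 [f /eqP]; apply.
  have [t tE] := tauP f.
  have -> : f x = t (0, x).1; last exact: linear0.
  rewrite -[x in LHS]/(0 : A, x).2 sE.
  elim: s {sE} => [|q s IH]; first by rewrite big_nil !linear0.
  by rewrite big_cons /= [LHS]linearD [RHS]linearD /= tE IH.
exists tau => x y; have /= -> // := tauG (lie x y, Phi x y).
by exists [:: (x, y)]; rewrite big_seq1.
Qed.
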